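(* Let $H=(V,E)$ be a hypergraph on $n$ vertices with $m$ edges and with the property that no edge contains another. Let $Z(H)$ be the set of all versals of $H$. Then the cardinality of $Z(H)$ is at least $n+1$ unless $H$ is (a) the set of all singletons $S_n$, (b) the set of all complements of singletons $\widetilde{S}_n$, (c) the graph $C_4$ (the four-cycle). In those cases, the cardinality of $Z(H)$ is $n$.
   Context: A hypergraph $H=(V,E)$ on $n$ vertices and $m$ edges consists of a vertex set $V$ with $|V|=n$ and a set $E$ of $m$ subsets of $V$ (the edges). A set of vertices $S\subseteq V$ is a versal for the edge $e\in E$ if for every other edge $f\in E$, $$|e|+|S\cap e|<|f|+|S\cap f|.$$ $L(e)=L(H,e)$ denotes the set of all versals for the edge $e$, and $Z(H)=\bigcup\{L(e)\mid e\in E\}$ is the set of all versals. $S_n$ is the hypergraph on $n$ vertices whose edges are the sets $\{v\}$, $v\in V$; $\widetilde{S}_n$ is the hypergraph on $n$ vertices whose edges are the sets $V\setminus\{v\}$, $v\in V$; and $C_4$ is the four-cycle graph, with $V=\{v_1,v_2,v_3,v_4\}$ and edges $\{v_1,v_2\},\{v_2,v_3\},\{v_3,v_4\},\{v_4,v_1\}$.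
   Formalization: The bound n+1 is claimed only for hypergraphs with at least one edge (with no edges Z(H) is empty), and the count n in the exceptional cases only for n ≠ 1 (for n = 1 the single edge makes both subsets versals, so Z(H) has 2 elements). *)

(* Defs.v *)
From mathcomp Require Import all_boot.

Set Implicit Arguments.
Unset Strict Implicit.
Unset Printing Implicit Defensive.

(* A hypergraph on the vertex set V is given by its edge set
   E : {set {set V}}; in particular there are no repeated edges. *)

Section Versals.

Variable V : finType.
Implicit Types (E : {set {set V}}) (S e f : {set V}).

Definition antichain E : Prop :=
  forall e f, e \in E -> f \in E -> e \subset f -> e = f.

Definition versal E e S : bool :=
  [forall f in E, (f != e) ==> (#|e| + #|S :&: e| < #|f| + #|S :&: f|)].

(* Only meaningful for e \in E. *)
Definition versals_of E e : {set {set V}} := [set S | versal E e S].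

Definition versals E : {set {set V}} := \bigcup_(e in E) versals_of E e.

Definition singletons : {set {set V}} := [set [set v] | v : V].

Definition cosingletons : {set {set V}} := [set ~: [set v] | v : V].

Definition is_C4 E : Prop :=
  exists v1 v2 v3 v4 : V,
    [/\ uniq [:: v1; v2; v3; v4],
        [set: V] = [set v1; v2; v3; v4] &
        E = [set [set v1; v2]; [set v2; v3]; [set v3; v4]; [set v4; v1]]].

Definition exceptional E : Prop :=
  [\/ E = singletons, E = cosingletons | is_C4 E].

End Versals.

Arguments singletons V : clear implicits.
Arguments cosingletons V : clear implicits.

(* Main.v *)
Require Import Defs.
From mathcomp Require Import all_boot.
From mathcomp Require Import zify.

(* Let k be the least size of an edge, F the set of edges of size k, and Z the
   set of complements of versals. Z contains F; it contains f - v when v in f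
   cannot be swapped out of f within F, and f + u when u not in f cannot be
   swapped into f; larger edges never interfere with these sets.

   Fix e in F. The swaps at e form a bipartite graph, with d edges and without
   isolated vertices, between the a removable vertices of e and the b addable
   vertices outside e. The members of Z that differ from e by at most one
   deletion and one insertion number at least 1 + (n - a - b) + d. If the graph
   is complete, then d = ab >= a + b - 1. Otherwise every pair {v, v'} of
   removable vertices with different neighbourhoods yields a further X in Z
   with e \ X = {v, v'}; there are at least a - 1 such pairs and d >= b. Hence
   |Z| >= n. Equality in the second case forces C_4. Equality in the first case
   forces a = 1 or b = 1, and at a neighbour of e every vertex is removable or
   addable, so that k = 1 or k = n - 1. *)

Set Implicit Arguments.
Unset Strict Implicit.
Unset Printing Implicit Defensive.

Section Swaps.

Variable V : finType.
Implicit Types (E F : {set {set V}}) (e f g S X D : {set V}) (u v x y : V).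

(** * Exchanging one element of a set *)

Definition swap e v u : {set V} := u |: e :\ v.

Lemma in_swap e v u x :
  (x \in swap e v u) = (x == u) || (x != v) && (x \in e).
Proof. by rewrite !inE. Qed.

Lemma swapK e v u : v \in e -> u \notin e -> swap (swap e v u) u v = e.
Proof.
move=> ve ue; apply/setP=> x; rewrite !inE.
by case: (eqVneq x v) => [->|_] /=; [rewrite ve | case: (eqVneq x u) => [->|]; rewrite ?(negPf ue)].
Qed.

Lemma swap_swap e v v' u : v' != v -> v \in e -> u \notin e -> v' \in e ->
  swap (swap e v u) v' v = swap e v' u.
Proof.
move=> nv ve ue v'e; apply/setP=> x; rewrite !inE.
have nuv' : u != v' by apply: contraNneq ue => ->.
case: (eqVneq x v) => [->|_] /=; first by rewrite ve (eq_sym v v') nv orbT.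
by case: (eqVneq x u) => [->|]; rewrite ?nuv'.
Qed.

Lemma swap_out e v u : v \in e -> u \notin e -> e :\: swap e v u = [set v].
Proof.
move=> ve ue; apply/setP=> x; rewrite !inE.
case: (eqVneq x v) => [->|_] /=; last by case: (x \in e); rewrite ?orbT ?andbF.
by rewrite ve orbF andbT; apply: contraNneq ue => <-.
Qed.

Lemma swap_in e v u : v \in e -> u \notin e -> swap e v u :\: e = [set u].
Proof.
move=> ve ue; apply/setP=> x; rewrite !inE.
case: (eqVneq x u) => [->|_] /=; first by rewrite ue.
by case: (x \in e); rewrite ?andbF.
Qed.

Lemma eq_set_diffs e X Y : e :\: X = e :\: Y -> X :\: e = Y :\: e -> X = Y.
Proof.
move=> /setP h1 /setP h2; apply/setP=> x; move: (h1 x) (h2 x); rewrite !inE.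
by case: (x \in e); case: (x \in X); case: (x \in Y).
Qed.

Lemma card_setU_disjoint (T : finType) (A B : {set T}) :
  [disjoint A & B] -> #|A :|: B| = #|A| + #|B|.
Proof. by move=> AB; apply/eqP; rewrite (leq_card_setU A B). Qed.

(** * Sets of [Z] near a smallest edge *)

Section Uniform.

(* Z stands for the set of complements of the versals of a hypergraph whose
   smallest edges, of size k, are the members of F. *)
Variables (F Z : {set {set V}}) (k : nat).
Hypothesis F_card : forall f, f \in F -> #|f| = k.
Hypothesis F_sub_Z : F \subset Z.
Hypothesis Z_del : forall f v, f \in F -> v \in f ->
  (forall u, u \notin f -> swap f v u \notin F) -> f :\ v \in Z.
Hypothesis Z_add : forall f u, f \in F -> u \notin f ->
  (forall v, v \in f -> swap f v u \notin F) -> u |: f \in Z.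

(** The edge set of the bipartite swap graph at e; [removable e] and [addable e] are its
    non-isolated vertices on either side. *)
Definition swaps e : {set V * V} :=
  [set p | [&& p.1 \in e, p.2 \notin e & swap e p.1 p.2 \in F]].
Definition removable e : {set V} := [set p.1 | p in swaps e].
Definition addable e : {set V} := [set p.2 | p in swaps e].
Definition far e : {set {set V}} :=
  [set X in Z | (1 < #|e :\: X|) || (1 < #|X :\: e|)].

Lemma swapsP e v u :
  reflect [/\ v \in e, u \notin e & swap e v u \in F] ((v, u) \in swaps e).
Proof. by rewrite inE; apply: and3P. Qed.

Lemma removableP e v : reflect (exists u, (v, u) \in swaps e) (v \in removable e).
Proof.
apply: (iffP imsetP) => [[[w u] h /= ->]|[u h]]; first by exists u.
by exists (v, u).
Qed.

Lemma addableP e u : reflect (exists v, (v, u) \in swaps e) (u \in addable e).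
Proof.
apply: (iffP imsetP) => [[[v w] h /= ->]|[v h]]; first by exists v.
by exists (v, u).
Qed.

Lemma del_notin_removable e v :
  e \in F -> v \in e -> v \notin removable e -> e :\ v \in Z.
Proof.
move=> eF ve /removableP h; apply: Z_del => // u ue; apply/negP=> hs.
by apply: h; exists u; apply/swapsP.
Qed.

Lemma add_notin_addable e u :
  e \in F -> u \notin e -> u \notin addable e -> u |: e \in Z.
Proof.
move=> eF ue /addableP h; apply: Z_add => // v ve; apply/negP=> hs.
by apply: h; exists v; apply/swapsP.
Qed.

Lemma removable_sub e : removable e \subset e.
Proof. by apply/subsetP=> v /removableP [u /swapsP []]. Qed.

Lemma addable_sub e : addable e \subset ~: e.
Proof. by apply/subsetP=> u /addableP [v /swapsP []]; rewrite inE. Qed.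

(** The pair (|e \ X|, |X \ e|) is (0,0) for e itself, (1,0) for deletions, (0,1) for insertions,
    (1,1) for swaps, and has an entry above 1 on [far e], so these families are disjoint in [Z].
    Terms to be subtracted stand on the right because subtraction truncates. *)
Lemma card_Z_ge e : e \in F ->
  #|V| + 1 + #|swaps e| + #|far e| <= #|Z| + #|removable e| + #|addable e|.
Proof.
move=> eF.
pose Z1 := [set e :\ v | v in e :\: removable e].
pose Z2 := [set u |: e | u in ~: e :\: addable e].
pose Z3 := [set swap e p.1 p.2 | p in swaps e].
have d1 v : v \in e -> e :\: (e :\ v) = [set v].
  move=> ve; apply/setP=> x; rewrite !inE.
  by case: (eqVneq x v) => [->|_] //=; case: (x \in e).
have d1' v : (e :\ v) :\: e = set0.
  by apply/setP=> x; rewrite !inE; case: (x \in e); rewrite ?andbF.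
have d2 u : e :\: (u |: e) = set0.
  by apply/setP=> x; rewrite !inE; case: (x \in e); rewrite ?orbT ?andbF.
have d2' u : u \notin e -> (u |: e) :\: e = [set u].
  move=> ue; apply/setP=> x; rewrite !inE.
  by case: (eqVneq x u) => [->|_] /=; rewrite ?ue //; case: (x \in e).
have c1 : #|Z1| = #|e| - #|removable e|.
  rewrite card_in_imset ?cardsDS ?removable_sub //.
  move=> v w; rewrite !inE => /andP[_ ve] /andP[_ we] h.
  by apply: set1_inj; rewrite -d1 // h d1.
have c2 : #|Z2| = #|~: e| - #|addable e|.
  rewrite card_in_imset ?cardsDS ?addable_sub //.
  move=> v w; rewrite !inE => /andP[_ ve] /andP[_ we] h.
  by apply: set1_inj; rewrite -d2' // h d2'.
have c3 : #|Z3| = #|swaps e|.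
  rewrite card_in_imset // => -[v u] [w x] /swapsP [ve ue _] /swapsP [we xe _] /= h.
  congr pair; apply: set1_inj.
    by rewrite -(swap_out ve ue) h swap_out.
  by rewrite -(swap_in ve ue) h swap_in.
have i1 X : X \in Z1 -> [/\ #|e :\: X| = 1, #|X :\: e| = 0 & X \in Z].
  move=> /imsetP [v]; rewrite inE => /andP[nr ve] ->.
  by rewrite d1 // d1' cards1 cards0 del_notin_removable.
have i2 X : X \in Z2 -> [/\ #|e :\: X| = 0, #|X :\: e| = 1 & X \in Z].
  move=> /imsetP [v]; rewrite !inE => /andP[nr ve] ->.
  by rewrite d2 // d2' // cards1 cards0 add_notin_addable.
have i3 X : X \in Z3 -> [/\ #|e :\: X| = 1, #|X :\: e| = 1 & X \in Z].
  move=> /imsetP [[v u] /swapsP [ve ue h]] -> /=.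
  by rewrite swap_out // swap_in // !cards1 (subsetP F_sub_Z).
have dis (A B : {set {set V}}) : (forall X, X \in A -> X \in B -> False) -> [disjoint A & B].
  move=> h; rewrite -setI_eq0; apply/eqP/setP=> X; rewrite !inE.
  by apply/negP=> /andP[/h].
have sub : (((e |: far e) :|: Z1) :|: Z2) :|: Z3 \subset Z.
  apply/subsetP=> X; rewrite !in_setU => /orP[/orP[/orP[/orP[]|]|]|].
  - by rewrite inE => /eqP ->; apply: (subsetP F_sub_Z).
  - by rewrite inE => /andP[].
  - by case/i1.
  - by case/i2.
  - by case/i3.
have in0 X : X \in e |: far e ->
    (#|e :\: X| = 0 /\ #|X :\: e| = 0) \/ (1 < #|e :\: X| \/ 1 < #|X :\: e|).
  rewrite !inE => /orP[/eqP ->|/andP[_ /orP]]; last by right.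
  by left; rewrite setDv cards0.
have := subset_leq_card sub.
rewrite card_setU_disjoint; last first.
  apply: dis => X; rewrite 2!in_setU => /orP[/orP[/in0 h|/i1 [h h' _]]|/i2 [h h' _]] /i3 [h1 h2 _]; lia.
rewrite card_setU_disjoint; last first.
  apply: dis => X; rewrite in_setU => /orP[/in0 h|/i1 [h h' _]] /i2 [h1 h2 _]; lia.
rewrite card_setU_disjoint; last first.
  by apply: dis => X /in0 h /i1 [h1 h2 _]; lia.
rewrite cardsU1 inE setDv cards0 andbF /= c1 c2 c3 => l1.
have l2 : #|removable e| <= #|e| := subset_leq_card (removable_sub e).
have l3 : #|addable e| <= #|~: e| := subset_leq_card (addable_sub e).
have l4 : #|e| + #|~: e| = #|V| := cardsC e.
move: l1 l2 l3 l4; move: #|V| #|e| #|~: e| #|removable e| #|addable e|.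
by move: #|swaps e| #|far e| #|Z| => *; lia.
Qed.

(** * Far sets from pairs of removable vertices *)

(** Pass to f = [swap e v u] and get rid of v' as well: either v' can be swapped out of f, which
    yields a member of [F], or f - v' lies in [Z]. The last clause records which case occurred. *)
Lemma far_swap e v v' u : (v, u) \in swaps e -> v' \in e -> v' != v ->
    (v', u) \notin swaps e ->
  exists X, [/\ X \in far e, e :\: X = [set v; v'], u \in X :\: e &
    X :\: e = [set u] \/ X \in F /\ #|X :\: e| = 2].
Proof.
move=> /swapsP [ve ue hF] v'e nv /swapsP h.
set f := swap e v u in hF.
have v'u : v' != u by apply: contraNneq ue => <-.
have v'f : v' \in f by rewrite !inE nv v'e orbT.
have fe := in_swap e v u : forall x, (x \in f) = _.
case: (boolP (v' \in removable f)) => [/removableP [u' /swapsP [_ u'f hF']]|nr].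
  (* Bringing v back in exchange for v' would give [swap e v' u], which is not in [F]. *)
  have u'v : u' != v.
    apply/eqP=> E; apply: h; split=> //.
    by move: hF'; rewrite E /f swap_swap.
  have u'e : u' \notin e by move: u'f; rewrite fe u'v negb_or => /andP[].
  have u'u : u' != u by move: u'f; rewrite fe negb_or => /andP[].
  have E1 : e :\: swap f v' u' = [set v; v'].
    apply/setP=> x; rewrite in_setD in_swap fe !inE.
    case: (eqVneq x v) => [->|xv] /=.
      by rewrite ve !(eq_sym v) (negPf u'v) (negPf nv); case: (eqVneq u v) ue => [->|]; rewrite ?ve.
    case: (eqVneq x v') => [->|xv'] /=.
      by rewrite v'e orbF andbT; apply: contraNneq u'e => <-.
    by case: (x \in e); rewrite ?orbT ?andbF.
  have E2 : swap f v' u' :\: e = [set u; u'].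
    apply/setP=> x; rewrite in_setD in_swap fe !inE.
    case: (eqVneq x u) => [->|xu] /=; first by rewrite (eq_sym u v') v'u ue orbT.
    by case: (eqVneq x u') => [->|xu']; rewrite ?u'e //=; case: (x \in e); rewrite ?andbF.
  exists (swap f v' u'); rewrite E2 in_set2 eqxx cards2 eq_sym u'u.
  split=> //; last by right.
  by rewrite inE (subsetP F_sub_Z) // E1 cards2 eq_sym nv.
have E1 : e :\: (f :\ v') = [set v; v'].
  apply/setP=> x; rewrite in_setD in_setD1 fe !inE.
  case: (eqVneq x v) => [->|xv] /=.
    by rewrite ve !(eq_sym v) (negPf nv); case: (eqVneq u v) ue => [->|]; rewrite ?ve.
  case: (eqVneq x v') => [->|xv'] /=; first by rewrite v'e.
  by case: (x \in e); rewrite ?orbT ?andbF.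
have E2 : (f :\ v') :\: e = [set u].
  apply/setP=> x; rewrite in_setD in_setD1 fe !inE.
  case: (eqVneq x u) => [->|xu] /=; first by rewrite (eq_sym u v') v'u ue.
  by case: (x \in e); rewrite ?andbF.
exists (f :\ v'); rewrite E2 inE eqxx; split=> //; last by left.
by rewrite inE del_notin_removable // E1 cards2 eq_sym nv.
Qed.

(** Pairs of removable vertices with different neighbourhoods in the swap graph, unordered because a
    far set X sees such a pair only as e \ X. *)
Definition separated e : {set {set V}} :=
  [set D | [exists v, exists v', exists u,
    [&& D == [set v; v'], v' \in removable e, (v, u) \in swaps e & (v', u) \notin swaps e]]].

Lemma separatedI e v v' u : v' \in removable e -> (v, u) \in swaps e ->
  (v', u) \notin swaps e -> [set v; v'] \in separated e.
Proof.
move=> h1 h2 h3; rewrite inE; apply/existsP; exists v; apply/existsP; exists v'.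
by apply/existsP; exists u; rewrite eqxx h1 h2 h3.
Qed.

Lemma card_separated_le e : #|separated e| <= #|far e|.
Proof.
apply: leq_trans (leq_imset_card (fun X => e :\: X) (far e)).
apply/subset_leq_card/subsetP=> D; rewrite inE.
move=> /existsP [v /existsP [v' /existsP [u /and4P [/eqP -> h1 h2 h3]]]].
have nv : v' != v by apply: contraNneq h3 => ->.
have [X [hX <- _ _]] := far_swap h2 (subsetP (removable_sub e) _ h1) nv h3.
by apply/imsetP; exists X.
Qed.

(** Adjacency to u splits the removable vertices into two classes, represented by v1 and v2, and any
    pair across the classes is separated. The pairs counted are the edges of the double star with
    centres v1 and v2, a spanning tree. *)
Lemma card_separated_ge e v1 v2 u : (v1, u) \in swaps e -> v2 \in removable e ->
  (v2, u) \notin swaps e -> #|removable e| <= #|separated e|.+1.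
Proof.
move=> h1 h2 h3.
have r1 : v1 \in removable e by apply/removableP; exists u.
pose q x := if (x, u) \in swaps e then [set x; v2] else [set v1; x].
rewrite (cardsD1 v1) r1 add1n ltnS.
rewrite -(card_in_imset (f := q) (D := mem (removable e :\ v1))); last first.
  have aux x y : x != v1 -> (x, u) \in swaps e -> (y, u) \notin swaps e ->
      [set x; v2] = [set v1; y] -> False.
    move=> xv1 hx hy /setP /(_ x); rewrite !inE eqxx (negPf xv1) /=.
    by case: eqP => // xy; rewrite -xy hx in hy.
  move=> x y; rewrite !inE => /andP[xv1 xr] /andP[yv1 yr].
  rewrite /q; case: ifPn => hx; case: ifPn => hy h.
  - move/setP/(_ x): h; rewrite !inE eqxx /= => /esym/orP[/eqP //|/eqP xv].
    by rewrite -xv hx in h3.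
  - by case: (aux x y).
  - by case: (aux y x).
  - move/setP/(_ x): h; rewrite !inE eqxx orbT (negPf xv1) /=.
    by move=> /esym/eqP.
apply/subset_leq_card/subsetP=> D /imsetP [x]; rewrite in_setD1 => /andP[xv1 xr] ->.
rewrite /q; case: ifPn => hx; first exact: separatedI h2 hx h3.
exact: separatedI xr h1 hx.
Qed.

(** * The cases of equality *)

(** Equal sizes make |e \ f| = |f \ e|, and outside [far e] this number is 0 or 1. *)
Lemma notin_farP e f : e \in F -> f \in F -> f \notin far e ->
  f = e \/ exists v u, (v, u) \in swaps e /\ f = swap e v u.
Proof.
move=> eF fF; rewrite inE (subsetP F_sub_Z) //= negb_or -!leqNgt => /andP[h1 h2].
have hc : #|e :\: f| = #|f :\: e|.
  have := cardsID f e; have := cardsID e f.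
  by rewrite (setIC f e) (F_card eF) (F_card fF); lia.
case: (posnP #|e :\: f|) => h0.
  left; apply/esym/eqP; rewrite eqEcard !F_card // leqnn andbT.
  by rewrite -setD_eq0 -cards_eq0 h0.
have /eqP/cards1P [v hv] : #|e :\: f| = 1 by lia.
have /eqP/cards1P [u hu] : #|f :\: e| = 1 by lia.
have /setDP [ve vf] : v \in e :\: f by rewrite hv set11.
have /setDP [uf ue] : u \in f :\: e by rewrite hu set11.
right; exists v, u.
have E : f = swap e v u by apply: (@eq_set_diffs e); rewrite ?swap_out ?swap_in.
by split=> //; apply/swapsP; rewrite -E.
Qed.

Definition complete_swaps e : Prop :=
  forall v u, v \in removable e -> u \in addable e -> (v, u) \in swaps e.

(* With |Z| <= |V|, the bounds on Z, on [far e] and on [separated e] are all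
   attained: the swaps at e form a perfect matching between two removable and
   two addable vertices, and [far e] is a single set g. The deletion and
   insertion conditions at g then leave no room for further vertices. *)
Lemma C4_of_few e v2 u1 : e \in F -> #|Z| <= #|V| ->
  v2 \in removable e -> u1 \in addable e -> (v2, u1) \notin swaps e -> is_C4 F.
Proof.
move=> eF hZ hv2 /addableP [v1 s1] hn.
have l1 : #|addable e| <= #|swaps e| := leq_imset_card _ _.
(* For a removable vertices, b addable vertices and d swaps, [card_Z_ge] gives d + |far e| + 1 <= a
   + b, while d >= b and |far e| >= a - 1. *)
have [cB cfar] : #|addable e| = #|swaps e| /\ #|far e| < #|removable e|.
  move: hZ l1 (card_separated_le e) (card_separated_ge s1 hv2 hn) (card_Z_ge eF).
  move: #|V| #|Z| #|far e| #|swaps e| #|removable e| #|addable e| #|separated e|.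
  by move=> *; lia.
have inj v w u : (v, u) \in swaps e -> (w, u) \in swaps e -> v = w.
  have /imset_injP h : #|addable e| == #|swaps e| by rewrite cB.
  by move=> a b; case: (h _ _ a b erefl).
have r1 : v1 \in removable e by apply/removableP; exists u1.
have nv : v2 != v1 by apply: contraNneq hn => ->.
(* Each addable vertex has a single partner, so distinct removable vertices have disjoint nonempty
   neighbourhoods and all a(a-1)/2 pairs are separated. As |far e| < a, this forces a = 2. *)
have sepA : [set D : {set V} | D \subset removable e & #|D| == 2] \subset separated e.
  apply/subsetP=> D /setIdP[DA /cards2P[x [y [xy DE]]]].
  have /removableP [u xu] : x \in removable e by rewrite (subsetP DA) // DE !inE eqxx.
  have yA : y \in removable e by rewrite (subsetP DA) // DE !inE eqxx orbT.
  rewrite DE; apply: (separatedI yA xu); apply: contraNN xy => yu.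
  by rewrite (inj _ _ _ xu yu).
have := subset_leq_card sepA; rewrite cards_draws => l5.
have A2 : [set v1; v2] \subset removable e.
  by apply/subsetP=> x; rewrite !inE => /orP[] /eqP ->.
have := subset_leq_card A2; rewrite cards2 eq_sym nv => l6.
have l7 := mul_bin_left #|removable e| 1; rewrite bin1 in l7.
have cA : #|removable e| = 2.
  move: cfar l5 l6 l7 (card_separated_le e).
  by move: #|far e| #|removable e| #|separated e| => *; nia.
have cH : #|far e| = 1.
  move: cfar (card_separated_le e) (card_separated_ge s1 hv2 hn); rewrite cA.
  by move: #|far e| #|separated e| => *; lia.
have AE : removable e = [set v1; v2].
  by apply/esym/eqP; rewrite eqEcard A2 cA cards2 eq_sym nv.
have [v1e u1e f1F] := swapsP _ _ _ s1.
case/removableP: (hv2) => u2 s2; have [v2e u2e f2F] := swapsP _ _ _ s2.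
have hn' : (v1, u2) \notin swaps e.
  by apply: contraNN nv => /(inj _ _ _ s2) ->.
have [g [gfar ge u1g gF]] := far_swap s1 v2e nv hn.
have uniqfar X : X \in far e -> X = g.
  have /eqP/cards1P [Y hY] := cH.
  by move=> h; move: gfar h; rewrite hY !inE => /eqP -> /eqP.
(* A swap (x, u) and a vertex w not joined to u yield a far set containing u; it can only be g. *)
have vg x w u : (x, u) \in swaps e -> w \in e -> w != x -> (w, u) \notin swaps e -> u \in g :\: e.
  move=> a b c d; have [X [Xf _ uX _]] := far_swap a b c d.
  by rewrite -(uniqfar X).
have u2g : u2 \in g :\: e by apply: (vg _ _ _ s2 v1e _ hn'); rewrite eq_sym.
have u12 : u1 != u2 by apply: contraNneq hn => ->.
(* Since g gains both u1 and u2, it is not a far set gaining u1 alone, so it lies in [F]. *)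
case: gF => [gE|[gF gc]]; first by move: u2g u12; rewrite gE inE eq_sym => /eqP ->; rewrite eqxx.
have gE : g :\: e = [set u1; u2].
  apply/esym/eqP; rewrite eqEcard gc cards2 u12 andbT.
  by apply/subsetP=> x; rewrite !inE => /orP[] /eqP ->; [move: u1g|move: u2g]; rewrite inE.
have swE x u : (x, u) \in swaps e -> (x, u) = (v1, u1) \/ (x, u) = (v2, u2).
  move=> xu; have xA : x \in removable e by apply/removableP; exists u.
  have ug : u \in [set u1; u2].
    rewrite -gE; move: xA; rewrite AE in_set2 => /orP[] /eqP E; rewrite E in xu.
      apply: (vg _ _ _ xu v2e nv).
      by apply: contraNN nv => /(inj _ _ _ xu) ->.
    apply: (vg _ _ _ xu v1e); first by rewrite eq_sym.
    by apply: contraNN nv => h; rewrite (inj _ _ _ xu h).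
  move: ug xu; rewrite in_set2 => /orP[] /eqP -> xu.
    by left; rewrite (inj _ _ _ xu s1).
  by right; rewrite (inj _ _ _ xu s2).
have bigfar X : X \in Z -> v1 \notin X -> v2 \notin X -> X \in far e.
  move=> XZ n1 n2; rewrite inE XZ /=; apply/orP; left.
  have <- : #|[set v1; v2]| = 2 by rewrite cards2 eq_sym nv.
  by apply/subset_leq_card/subsetP=> x; rewrite !inE => /orP[] /eqP ->; apply/andP.
have ngv : (v1 \notin g) && (v2 \notin g).
  have : v1 \in e :\: g by rewrite ge !inE eqxx.
  have : v2 \in e :\: g by rewrite ge !inE eqxx orbT.
  by rewrite !inE => /andP[-> _] /andP[-> _].
case/andP: ngv => ng1 ng2.
(* A fifth vertex x would permit a deletion, insertion or swap at g involving x. The result is far,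
   hence equal to g, which is absurd; the one exception is x swapped out of g, where the result may
   be e or a swap at e, but these all contain x. *)
have VE x : x \in [set v1; v2; u1; u2].
  apply/negPn/negP=> nx.
  move: (nx); rewrite !inE !negb_or -!andbA => /and4P [xv1 xv2 xu1 xu2].
  case: (boolP (x \in g)) => xg.
    case: (boolP (x \in removable g)) => [/removableP [y /swapsP [_ yg hF]]|nr]; last first.
      have /uniqfar/setP/(_ x) : g :\ x \in far e.
        by apply: bigfar; rewrite ?del_notin_removable // !inE ?(negPf ng1) ?(negPf ng2) andbF.
      by rewrite !inE eqxx xg.
    have xy : x != y by apply: contraNneq yg => <-.
    case: (boolP (swap g x y \in far e)) => [/uniqfar/setP/(_ x)|].
      by rewrite !inE eqxx (negPf xy) xg.
    have xe : x \in e.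
      by have := in_set2 x u1 u2; rewrite -gE inE xg andbT (negPf xu1) (negPf xu2) => /negbFE.
    have xs z w : x != z -> swap g x y = swap e z w -> False.
      by move=> xz /setP/(_ x); rewrite !inE eqxx (negPf xy) xz xe /= orbT.
    move=> /(notin_farP eF hF) [/setP/(_ x)|[z [w [/swE [] [-> ->] /xs]]]].
    - by rewrite !inE eqxx xe (negPf xy).
    - exact.
    - exact.
  case: (boolP (x \in addable g)) => [/addableP [y /swapsP [yg _ hF]]|nr]; last first.
    have /uniqfar/setP/(_ x) : x |: g \in far e.
      by apply: bigfar; rewrite ?add_notin_addable // !inE negb_or eq_sym ?xv1 ?xv2.
    by rewrite !inE eqxx (negPf xg).
  have /uniqfar/setP/(_ x) : swap g y x \in far e.
    apply: bigfar; rewrite ?(subsetP F_sub_Z) // !inE negb_or negb_and ?ng1 ?ng2 orbT andbT.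
      by rewrite eq_sym.
    by rewrite eq_sym.
  by rewrite !inE eqxx (negPf xg).
have xcase (P : V -> Prop) : P v1 -> P v2 -> P u1 -> P u2 -> forall x, P x.
  by move=> p1 p2 p3 p4 x; have := VE x; rewrite !inE -!orbA => /or4P[] /eqP ->.
have [u1g' u2g'] : u1 \in g /\ u2 \in g by move: u1g u2g; rewrite !inE => /andP[_ ->] /andP[_ ->].
have n11 : v1 != u1 by apply: contraNneq u1e => <-.
have n12 : v1 != u2 by apply: contraNneq u2e => <-.
have n21 : v2 != u1 by apply: contraNneq u1e => <-.
have n22 : v2 != u2 by apply: contraNneq u2e => <-.
have nE := (negPf nv, negPf n11, negPf n12, negPf n21, negPf n22, negPf u12).
have nE' := (eq_sym v1 v2, eq_sym u1 v1, eq_sym u1 v2, eq_sym u2 v1, eq_sym u2 v2, eq_sym u2 u1).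
(* The cycle is e = {v1, v2}, {v2, u1}, g = {u1, u2}, {u2, v1}; the second and fourth edges are the
   two swaps at e. *)
exists v1, v2, u1, u2; split.
- by rewrite /= !inE !nE' !nE.
- by apply/setP=> x; rewrite inE; apply/esym/VE.
have eE : e = [set v1; v2].
  apply/setP; apply: xcase; rewrite !inE ?nE' ?nE ?eqxx ?v1e ?v2e //;
  exact: negPf.
have gE' : g = [set u1; u2].
  by apply/setP; apply: xcase; rewrite !inE ?nE' ?nE ?eqxx ?u1g' ?u2g' //; exact: negPf.
have f1E : swap e v1 u1 = [set v2; u1].
  by rewrite eE; apply/setP; apply: xcase; rewrite !inE ?nE' ?nE ?eqxx.
have f2E : swap e v2 u2 = [set u2; v1].
  by rewrite eE; apply/setP; apply: xcase; rewrite !inE ?nE' ?nE ?eqxx.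
apply/setP=> f; rewrite -f1E -f2E -gE' -eE 3!in_setU !inE.
apply/idP/idP; last first.
  by rewrite -!orbA => /or4P[] /eqP ->.
move=> fF; case: (boolP (f \in far e)) => [/uniqfar ->|/(notin_farP eF fF)].
  by rewrite eqxx !orbT.
by case=> [->|[x [y [/swE [] [-> ->] ->]]]]; rewrite eqxx ?orbT.
Qed.

(** With a removable and b addable vertices there are ab swaps, so [card_Z_ge] becomes (a - 1)(b -
    1) + |far e| <= 0. *)
Lemma few_complete e : e \in F -> #|Z| <= #|V| -> complete_swaps e ->
  [/\ far e == set0, swaps e != set0 & #|removable e| = 1 \/ #|addable e| = 1].
Proof.
move=> eF hZ hc.
have E : swaps e = setX (removable e) (addable e).
  apply/setP=> -[v u]; rewrite in_setX; apply/idP/andP => [h|[]]; last exact: hc.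
  by split; [apply/removableP; exists u | apply/addableP; exists v].
have cc : #|swaps e| = #|removable e| * #|addable e| by rewrite E cardsX.
have c0 : #|swaps e| == 0 -> #|removable e| = 0 /\ #|addable e| = 0.
  by rewrite cards_eq0 => /eqP E0; rewrite /removable /addable E0 !imset0 !cards0.
rewrite -!cards_eq0; move: cc c0 hZ (card_Z_ge eF).
move: #|Z| #|V| #|far e| #|swaps e| #|removable e| #|addable e| => z n f s a b sab s0 zn l.
have {}s0 : s != 0 by apply/negP=> /s0 [a0 b0]; lia.
case: a b sab l => [|a] [|b] sab l; try lia.
split=> //; nia.
Qed.

Lemma few_exceptional e : e \in F -> #|Z| <= #|V| -> exceptional F.
Proof.
move=> e0F hZ.
have dich e' : e' \in F -> is_C4 F \/ complete_swaps e'.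
  move=> e'F.
  case: (boolP [exists v, exists u, [&& v \in removable e', u \in addable e' & (v, u) \notin swaps e']]).
    by move=> /existsP [v /existsP [u /and3P [h1 h2 h3]]]; left; apply: C4_of_few h1 h2 h3.
  move=> /existsPn h; right=> v u hv hu; have /existsPn/(_ u) := h v.
  by rewrite hv hu /= negbK.
case: (dich e) => // [|ce]; first by constructor 3.
have [/eqP far0 /set0Pn [[v u] s] _] := few_complete e0F hZ ce.
have [ve ue fF] := swapsP _ _ _ s.
set f := swap e v u in fF.
have uf : u \in f by rewrite !inE eqxx.
have uv : u != v by apply: contraNneq ue => ->.
have vf : v \notin f by rewrite !inE eq_sym (negPf uv) eqxx.
have sf : (u, v) \in swaps f by apply/swapsP; split=> //; rewrite /f swapK.
(* If some x in f other than u were not removable, f - x would lie in [Z] and miss both v and x from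
   e, so it would be far from e. Dually, f + x gains both u and x in the proof of [af]. *)
have rf : removable f = f.
  apply/eqP; rewrite eqEsubset removable_sub; apply/subsetP=> x xf.
  case: (eqVneq x u) => [->|xu]; first by apply/removableP; exists v.
  apply/negPn/negP=> nr; have : f :\ x \in far e; last by rewrite far0 inE.
  rewrite inE del_notin_removable //=; apply/orP; left.
  have [xv xe] : x != v /\ x \in e by apply/andP; move: xf; rewrite !inE (negPf xu).
  have <- : #|[set v; x]| = 2 by rewrite cards2 eq_sym xv.
  apply/subset_leq_card/subsetP=> y; rewrite in_set2 in_setD in_setD1 => /orP[] /eqP ->.
    by rewrite (negPf vf) andbF ve.
  by rewrite eqxx xe.
have af : addable f = ~: f.
  apply/eqP; rewrite eqEsubset addable_sub; apply/subsetP=> x; rewrite inE => xf.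
  case: (eqVneq x v) => [->|xv]; first by apply/addableP; exists u.
  apply/negPn/negP=> nr; have : x |: f \in far e; last by rewrite far0 inE.
  rewrite inE add_notin_addable //=; apply/orP; right.
  have [xu xe] : x != u /\ x \notin e by apply/andP; move: xf; rewrite !inE xv negb_or.
  have <- : #|[set u; x]| = 2 by rewrite cards2 eq_sym xu.
  apply/subset_leq_card/subsetP=> y; rewrite in_set2 in_setD in_setU1 => /orP[] /eqP ->.
    by rewrite ue uf orbT.
  by rewrite eqxx xe.
case: (dich f) => // [|cf]; first by constructor 3.
have [_ _] := few_complete fF hZ cf.
(* So f or its complement is a single vertex, and completeness at f supplies all the other
   singletons or cosingletons. *)
rewrite rf af => -[] h1.
  constructor 1; have /eqP/cards1P [w fw] := h1.
  apply/setP=> g; apply/idP/imsetP => [gF|[x _ ->]].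
    have /eqP/cards1P [x ->] : #|g| = 1 by rewrite F_card // -(F_card fF).
    by exists x.
  case: (eqVneq x w) => [->|xw]; first by rewrite -fw.
  have /swapsP [_ _] : (w, x) \in swaps f by apply: cf; rewrite ?rf ?af fw !inE.
  by rewrite /swap fw setDv setU0.
constructor 2; have /eqP/cards1P [w fw] := h1.
apply/setP=> g; apply/idP/imsetP => [gF|[x _ ->]].
  have /eqP/cards1P [x gx] : #|~: g| = 1.
    by apply/eqP; rewrite -(eqn_add2l k) -{1}(F_card gF) cardsC -h1 -(F_card fF) cardsC.
  by exists x; rewrite // -gx setCK.
case: (eqVneq x w) => [->|xw]; first by rewrite -fw setCK.
have fw' : f = ~: [set w] by rewrite -fw setCK.
have /swapsP [_ _] : (x, w) \in swaps f by apply: cf; rewrite ?rf ?af fw' !inE // negbK.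
suff -> : swap f x w = ~: [set x] by [].
apply/setP=> y; rewrite fw' !inE; case: (eqVneq y w) => [->|] /=; last by rewrite andbT.
by rewrite eq_sym xw.
Qed.

End Uniform.

(** * Reduction to the layer of smallest edges *)

Lemma card_swap e v u : v \in e -> u \notin e -> #|swap e v u| = #|e|.
Proof. by move=> ve ue; rewrite cardsU1 !inE (negPf ue) andbF (cardsD1 v e) ve. Qed.

(** In terms of the complement X of a versal, the edge must be the strict minimiser of the cost |f|
    + |f \ X|. *)
Lemma versal_setC E e X : versal E e (~: X) =
  [forall f in E, (f != e) ==> (#|e| + #|e :\: X| < #|f| + #|f :\: X|)].
Proof. by apply: eq_forallb_in => f _; rewrite !setDE !(setIC (~: X)). Qed.

Lemma mem_covers E e X : e \in E ->
    (forall f, f \in E -> f != e -> #|e| + #|e :\: X| < #|f| + #|f :\: X|) ->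
  X \in [set ~: S | S in versals E].
Proof.
move=> eE h; rewrite -[X]setCK imset_f //; apply/bigcupP; exists e => //.
rewrite inE versal_setC; apply/forallP=> f.
by apply/implyP=> fE; apply/implyP; apply: h.
Qed.

Lemma min_layer_exceptional E k (F := [set f in E | #|f| == k]) :
    antichain E -> (forall f, f \in E -> k <= #|f|) -> F != set0 ->
  #|versals E| <= #|V| -> exceptional F.
Proof.
move=> hE kmin /set0Pn [e eF] hV.
have FE f : f \in F -> f \in E /\ #|f| = k by rewrite inE => /andP[-> /eqP].
have diff f g : f \in E -> g \in E -> g != f -> 0 < #|g :\: f|.
  move=> fE gE; rewrite card_gt0; apply: contraNneq => /eqP.
  by rewrite setD_eq0 => /hE ->.
apply: (@few_exceptional F [set ~: S | S in versals E] k _ _ _ _ e) => //.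
- by move=> f /FE [].
- apply/subsetP=> f /FE [fE fk]; apply: (mem_covers fE) => g gE gf.
  rewrite setDv cards0 fk; have := diff f g fE gE gf; have := kmin g gE; lia.
- move=> f v /FE [fE fk] vf hs; apply: (mem_covers fE) => g gE gf.
  have -> : f :\: (f :\ v) = [set v].
    apply/setP=> x; rewrite !inE.
    by case: (eqVneq x v) => [->|_] //=; case: (x \in f).
  rewrite cards1 fk ltnNge; apply/negP=> hle.
  (* Here f costs k + 1, and g \ f is nonempty by the antichain property. A competitor g thus has
     size k and a single element u outside f - v, with u not in f, so g is a swap of f. *)
  have sub : g :\: f \subset g :\: (f :\ v) by apply/setDS/subsetDl.
  have := subset_leq_card sub; have := kmin g gE; have := diff f g fE gE gf.
  move=> l1 l2 l3.
  have /eqP/cards1P [u hu] : #|g :\: (f :\ v)| = 1 by lia.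
  have /card_gt0P [w wgf] := l1.
  have uE : w = u by apply/set1P; rewrite -hu (subsetP sub).
  move: wgf; rewrite uE => /setDP [ug uf].
  have gk : #|g| = k by move: hle; rewrite hu cards1; lia.
  have gE' : g = swap f v u.
    apply/eqP; rewrite eqEcard card_swap // fk gk leqnn andbT.
    apply/subsetP=> x xg; rewrite in_setU1 -in_set1 -hu in_setD xg andbT.
    by case: (x \in f :\ v).
  by have := hs u uf; rewrite -gE' inE gE gk eqxx.
- move=> f u /FE [fE fk] uf hs; apply: (mem_covers fE) => g gE gf.
  have -> : f :\: (u |: f) = set0 by apply/eqP; rewrite setD_eq0 subsetUr.
  rewrite cards0 addn0 fk ltnNge; apply/negP=> hle.
  (* Now f costs only k, so a competitor has size k and lies inside f + u; again it is a swap of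
     f. *)
  have := kmin g gE => l1.
  have gk : #|g| = k by lia.
  have /eqP : #|g :\: (u |: f)| = 0 by lia.
  rewrite cards_eq0 setD_eq0 => gsub.
  have ug : u \in g.
    have /card_gt0P [w /setDP [wg wf]] := diff f g fE gE gf.
    by have := subsetP gsub _ wg; rewrite !inE (negPf wf) orbF => /eqP <-.
  have /set0Pn [v /setDP [vf vg]] : f :\: g != set0.
    by rewrite -card_gt0 diff // eq_sym.
  have gE' : g = swap f v u.
    apply/eqP; rewrite eqEcard card_swap // fk gk leqnn andbT.
    apply/subsetP=> x xg; have := subsetP gsub _ xg; rewrite !inE.
    by case/orP=> [->|->] //; rewrite andbT orbC; case: eqVneq vg => // <-; rewrite xg.
  by have := hs v vf; rewrite -gE' inE gE gk eqxx.
- rewrite card_imset //; exact: inv_inj setCK.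
Qed.

(** For singletons and cosingletons, any further edge would contain or be contained in a member of
    [F]. For the four-cycle, a set containing no edge lies in a diagonal. *)
Lemma min_layer_eq E k (F := [set f in E | #|f| == k]) :
    antichain E -> (forall f, f \in E -> k <= #|f|) -> F != set0 ->
  exceptional F -> E = F.
Proof.
move=> hE kmin /set0Pn [e eF] exF.
have FE f : f \in F -> f \in E /\ #|f| = k by rewrite inE => /andP[-> /eqP].
apply/eqP; rewrite eqEsubset; apply/andP; split; last by apply/subsetP=> f /FE [].
apply/subsetP=> g gE.
have above f : f \in F -> f \subset g -> g \in F.
  by move=> fF fg; have [fE _] := FE f fF; rewrite -(hE f g).
case: exF => [F1|F2|[v1 [v2 [v3 [v4 [u4 VE F4]]]]]].
- have /imsetP [v _ ev] : e \in singletons V by rewrite -F1.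
  have [_ ek] := FE e eF.
  have /card_gt0P [x xg] : 0 < #|g| by apply: leq_trans (kmin g gE); rewrite -ek ev cards1.
  by apply: (above [set x]); rewrite ?F1 ?sub1set // imset_f.
- case: (eqVneq g setT) => [gT|].
    by apply: (above e) => //; rewrite gT subsetT.
  rewrite -properT => /properP [_ [x _ xg]].
  have xF : ~: [set x] \in F by rewrite F2; apply: imset_f.
  have [xE _] := FE _ xF.
  by rewrite (hE g (~: [set x])) // subsetC sub1set inE.
- have [_ ek] := FE e eF.
  have k2 : k = 2.
    move: u4; rewrite /= !inE !negb_or -!andbA => /and5P [n12 n13 n14 n23 /and3P[n24 n34 _]].
    move: eF; rewrite F4 !inE -ek -!orbA => /or4P[] /eqP ->; rewrite cards2 ?n12 ?n23 ?n34 //.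
    by rewrite eq_sym n14.
  have pair a b : [set a; b] \in F -> a \in g -> b \in g -> g \in F.
    by move=> hF ag bg; apply: (above _ hF); apply/subsetP=> x; rewrite !inE => /orP[] /eqP ->.
  case: (boolP (g \in F)) => // gF.
  have npair a b : [set a; b] \in F -> (a \notin g) || (b \notin g).
    by move=> hF; rewrite -negb_and; apply: contra gF => /andP[]; apply: pair.
  have n1 : (v1 \notin g) || (v2 \notin g) by apply: npair; rewrite F4 !inE eqxx.
  have n2 : (v2 \notin g) || (v3 \notin g) by apply: npair; rewrite F4 !inE eqxx ?orbT.
  have n3 : (v3 \notin g) || (v4 \notin g) by apply: npair; rewrite F4 !inE eqxx ?orbT.
  have n4 : (v4 \notin g) || (v1 \notin g) by apply: npair; rewrite F4 !inE eqxx ?orbT.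
  (* [F] holds all edges of size k = 2, so it contains any edge lying within a pair. *)
  have small a b : g \subset [set a; b] -> g \in F.
    move=> gs; rewrite inE gE eqn_leq kmin // andbT k2.
    by apply: leq_trans (subset_leq_card gs) _; rewrite cards2; case: (a != b).
  have inV x : x \in [set v1; v2; v3; v4] by rewrite -VE.
  have sub (a b c d : V) : (forall x, x \in [:: a; b; c; d]) -> c \notin g -> d \notin g -> g \subset [set a; b].
    move=> h cg dg; apply/subsetP=> x xg; have := h x; rewrite !inE.
    case: (eqVneq x a) => //= _; case: (eqVneq x b) => //= _.
    by move=> /orP[] /eqP xE; rewrite xE ?(negPf cg) ?(negPf dg) in xg.
  case/negP: (gF); case: (boolP (v1 \in g)) => h1.
    apply: (small v1 v3); apply: (@sub _ _ v2 v4).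
    + by move=> x; have := inV x; rewrite !inE; do 4 case: (x == _).
    + by rewrite h1 in n1.
    + by rewrite h1 orbF in n4.
  case: (boolP (v3 \in g)) => h3.
    apply: (small v1 v3); apply: (@sub _ _ v2 v4).
    + by move=> x; have := inV x; rewrite !inE; do 4 case: (x == _).
    + by rewrite h3 orbF in n2.
    + by rewrite h3 in n3.
  apply: (small v2 v4); apply: (@sub _ _ v1 v3) => //.
  by move=> x; have := inV x; rewrite !inE; do 4 case: (x == _).
Qed.

Lemma card_versals_ge E : antichain E -> E != set0 -> ~ exceptional E ->
  #|V| < #|versals E|.
Proof.
move=> hE /set0Pn [e0 e0E] nex; rewrite ltnNge; apply/negP=> hle; apply: nex.
pose e := [arg min_(f < e0 in E) #|f|].
have [eE emin] : e \in E /\ forall f, f \in E -> #|e| <= #|f|.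
  by rewrite /e; case: arg_minnP.
have F0 : [set f in E | #|f| == #|e|] != set0 by apply/set0Pn; exists e; rewrite inE eE eqxx.
have ex := min_layer_exceptional hE emin F0 hle.
by rewrite (min_layer_eq hE emin F0 ex).
Qed.

(** * Versals of the exceptional hypergraphs *)

Lemma versalsP E S : reflect (exists2 e, e \in E & versal E e S) (S \in versals E).
Proof.
by apply: (iffP bigcupP) => -[e eE h]; exists e => //; move: h; rewrite inE.
Qed.

Lemma versalP E e S : reflect
  (forall f, f \in E -> f != e -> #|e| + #|S :&: e| < #|f| + #|S :&: f|) (versal E e S).
Proof.
apply: (iffP forallP) => h f; first by move=> fE; apply/implyP; have /implyP := h f; apply.
by apply/implyP=> fE; apply/implyP; apply: h.
Qed.

Lemma card_setI1 S v : #|S :&: [set v]| = (v \in S).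
Proof.
rewrite setIC; case: (boolP (v \in S)) => vS.
  by have /setIidPl -> : [set v] \subset S; rewrite ?sub1set ?cards1.
by apply/eqP; rewrite cards_eq0 setI_eq0 disjoints1.
Qed.

Lemma card_setID1 S v : #|S :&: ~: [set v]| + (v \in S) = #|S|.
Proof. by rewrite -(card_setI1 S v) -setDE addnC cardsID. Qed.

Lemma card_singletons : #|singletons V| = #|V|.
Proof. by rewrite card_imset ?cardsT //; apply: set1_inj. Qed.

Lemma card_cosingletons : #|cosingletons V| = #|V|.
Proof.
rewrite card_imset ?cardsT // => x y h.
by apply: set1_inj; rewrite -[LHS]setCK h setCK.
Qed.

Lemma exists_neq v : #|V| != 1 -> exists w, w != v.
Proof.
move=> n1; apply/existsP; apply: contraNT n1 => /existsPn h.
rewrite -cardsT (_ : setT = [set v]) ?cards1 //.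
by apply/setP=> x; rewrite !inE; have := h x; rewrite negbK => ->.
Qed.

(** A versal for {v} contains every vertex except v; that v is left out follows only by comparison
    with a second vertex. *)
Lemma versals_singletons : #|V| != 1 -> versals (singletons V) = cosingletons V.
Proof.
move=> n1; apply/setP=> S; apply/versalsP/imsetP => [[_ /imsetP [v _ ->] /versalP h]|[v _ ->]].
  have hv w : w != v -> v \notin S /\ w \in S.
    move=> wv; have := h [set w] (imset_f _ _) _.
    rewrite !cards1 !card_setI1 (inj_eq set1_inj) => /(_ isT wv).
    by case: (v \in S); case: (w \in S).
  exists v => //; apply/setP=> x; rewrite !inE.
  case: (eqVneq x v) => [->|/hv [] //].
  by have [w /hv [/negPf ->]] := exists_neq v n1.
exists [set v]; first exact: imset_f.
apply/versalP=> _ /imsetP [w _ ->]; rewrite (inj_eq set1_inj) => wv.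
by rewrite !cards1 !card_setI1 !inE eqxx wv.
Qed.

Lemma versals_cosingletons : #|V| != 1 -> versals (cosingletons V) = singletons V.
Proof.
move=> n1; apply/setP=> S.
(* Omitting v lowers the intersection with S by one exactly when v is in S. *)
have lt v w : (#|~: [set v]| + #|S :&: ~: [set v]| < #|~: [set w]| + #|S :&: ~: [set w]|)
    = (v \in S) && (w \notin S).
  rewrite !cardsC1 ltn_add2l.
  have := card_setID1 S v; rewrite -(card_setID1 S w).
  by case: (v \in S); case: (w \in S) => /=; lia.
have neq v w : (~: [set w] != ~: [set v]) = (w != v).
  by rewrite (inj_eq (inv_inj setCK)) (inj_eq set1_inj).
apply/versalsP/imsetP => [[_ /imsetP [v _ ->] /versalP h]|[v _ Sv]].
  have hv w : w != v -> v \in S /\ w \notin S.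
    by move=> wv; have := h (~: [set w]) (imset_f _ _) _; rewrite lt neq => /(_ isT wv)/andP.
  exists v => //; apply/setP=> x; rewrite !inE.
  case: (eqVneq x v) => [->|/hv [_ /negPf ->] //].
  by have [w /hv [->]] := exists_neq v n1.
exists (~: [set v]); first exact: imset_f.
by apply/versalP=> _ /imsetP [w _ ->]; rewrite neq lt Sv !inE eqxx.
Qed.

Lemma card_setI2 S v w : v != w -> #|S :&: [set v; w]| = (v \in S) + (w \in S).
Proof.
move=> vw; rewrite setIUr card_setU_disjoint ?card_setI1 // -setI_eq0.
apply/eqP/setP=> x; rewrite !inE; case: (eqVneq x v) => [->|]; last by rewrite andbF.
by rewrite (negPf vw) !andbF.
Qed.

Lemma card_set4 (T : finType) (a b c d : T) :
  uniq [:: a; b; c; d] -> #|[set a; b; c; d]| = 4.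
Proof.
by move=> /card_uniqP /= <-; apply: eq_card => x; rewrite !inE -!orbA.
Qed.

(** The edges are the sets meeting each diagonal in exactly one vertex. Comparing an edge with its
    two neighbours on the cycle shows that its only versal is the opposite edge. *)
Lemma versals_C4 E : is_C4 E -> versals E = E /\ #|E| = #|V|.
Proof.
move=> [v1 [v2 [v3 [v4 [u4 VE EE]]]]].
move: u4; rewrite /= !inE !negb_or -!andbA => /and5P [n12 n13 n14 n23 /and3P[n24 n34 _]].
have n41 : v4 != v1 by rewrite eq_sym.
have xcase (P : V -> Prop) : P v1 -> P v2 -> P v3 -> P v4 -> forall x, P x.
  move=> p1 p2 p3 p4 x; have : x \in [set v1; v2; v3; v4] by rewrite -VE.
  by rewrite !inE -!orbA => /or4P[] /eqP ->.
have nE := (negPf n12, negPf n13, negPf n14, negPf n23, negPf n24, negPf n34).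
have nE' := (eq_sym v2 v1, eq_sym v3 v1, eq_sym v4 v1, eq_sym v3 v2, eq_sym v4 v2, eq_sym v4 v3).
have EP S : (S \in E) = ((v1 \in S) (+) (v3 \in S)) && ((v2 \in S) (+) (v4 \in S)).
  rewrite EE; apply/idP/idP => [|h].
    by rewrite !inE -!orbA => /or4P[] /eqP ->; rewrite !inE !nE' !nE !eqxx.
  have SE (T : {set V}) : (v1 \in S) = (v1 \in T) -> (v2 \in S) = (v2 \in T) ->
      (v3 \in S) = (v3 \in T) -> (v4 \in S) = (v4 \in T) -> S = T.
    by move=> *; apply/setP; apply: xcase.
  rewrite !in_setU !in_set1 -!orbA; apply/or4P.
  case s1: (v1 \in S) h; case s2: (v2 \in S); case s3: (v3 \in S); case s4: (v4 \in S) => // _.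
  - by constructor 1; apply/eqP/SE; rewrite !inE ?nE' ?nE ?eqxx.
  - by constructor 4; apply/eqP/SE; rewrite !inE ?nE' ?nE ?eqxx.
  - by constructor 2; apply/eqP/SE; rewrite !inE ?nE' ?nE ?eqxx.
  - by constructor 3; apply/eqP/SE; rewrite !inE ?nE' ?nE ?eqxx.
have pairs_neq a b c d : a != c -> a != d -> [set a; b] != [set c; d].
  by move=> ac ad; apply/eqP => /setP/(_ a); rewrite !inE eqxx (negPf ac) (negPf ad).
have E12 : [set v1; v2] \in E by rewrite EP !inE !nE' !nE !eqxx.
have E23 : [set v2; v3] \in E by rewrite EP !inE !nE' !nE !eqxx.
have E34 : [set v3; v4] \in E by rewrite EP !inE !nE' !nE !eqxx.
have E41 : [set v4; v1] \in E by rewrite EP !inE !nE' !nE !eqxx.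
have setE : forall P : {set V} -> Prop, P [set v1; v2] -> P [set v2; v3] ->
    P [set v3; v4] -> P [set v4; v1] -> forall f, f \in E -> P f.
  by move=> P p1 p2 p3 p4 f; rewrite EE !in_setU !in_set1 -!orbA => /or4P[] /eqP ->.
have d1 : [set v1; v2] != [set v2; v3] by apply: pairs_neq.
have d2 : [set v1; v2] != [set v3; v4] by apply: pairs_neq.
have d3 : [set v1; v2] != [set v4; v1] by rewrite setUC; apply: pairs_neq; rewrite // eq_sym.
have d4 : [set v2; v3] != [set v3; v4] by apply: pairs_neq.
have d5 : [set v2; v3] != [set v4; v1] by apply: pairs_neq; rewrite // eq_sym.
have d6 : [set v3; v4] != [set v4; v1] by apply: pairs_neq; rewrite // eq_sym.
have dE := (d1, d2, d3, d4, d5, d6).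
split; last first.
  rewrite EE -cardsT VE (@card_set4 _ v1) /= ?inE ?negb_or ?n12 ?n13 ?n14 ?n23 ?n24 ?n34 //.
  by rewrite card_set4 //= !inE !negb_or !dE.
apply/setP=> S; rewrite EP.
have cw a b : a != b -> #|[set a; b]| + #|S :&: [set a; b]| = 2 + ((a \in S) + (b \in S)).
  by move=> ab; rewrite cards2 ab card_setI2.
have cardE2 := (cw _ _ n12, cw _ _ n23, cw _ _ n34, cw _ _ n41).
apply/versalsP/idP.
  move=> [e eE /versalP h]; move: e eE h; apply: setE => h.
  - move: (h _ E23) (h _ E34) (h _ E41); rewrite !cardE2.
    by rewrite !(eq_sym _ [set v1; v2]) !dE; move=> /(_ isT) + /(_ isT) + /(_ isT); do 4 case: (_ \in S).
  - move: (h _ E12) (h _ E34) (h _ E41); rewrite !cardE2.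
    by rewrite !(eq_sym [set v3; v4]) !(eq_sym [set v4; v1]) !dE; move=> /(_ isT) + /(_ isT) + /(_ isT); do 4 case: (_ \in S).
  - move: (h _ E12) (h _ E23) (h _ E41); rewrite !cardE2.
    by rewrite !(eq_sym [set v4; v1]) !dE; move=> /(_ isT) + /(_ isT) + /(_ isT); do 4 case: (_ \in S).
  - move: (h _ E12) (h _ E23) (h _ E34); rewrite !cardE2.
    by rewrite !dE; move=> /(_ isT) + /(_ isT) + /(_ isT); do 4 case: (_ \in S).
case s1: (v1 \in S); case s2: (v2 \in S); case s3: (v3 \in S); case s4: (v4 \in S) => // _.
- exists [set v3; v4] => //; apply/versalP; apply: setE; by rewrite ?eqxx // !cardE2 ?s1 ?s2 ?s3 ?s4.
- exists [set v2; v3] => //; apply/versalP; apply: setE; by rewrite ?eqxx // !cardE2 ?s1 ?s2 ?s3 ?s4.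
- exists [set v4; v1] => //; apply/versalP; apply: setE; by rewrite ?eqxx // !cardE2 ?s1 ?s2 ?s3 ?s4.
- exists [set v1; v2] => //; apply/versalP; apply: setE; by rewrite ?eqxx // !cardE2 ?s1 ?s2 ?s3 ?s4.
Qed.

End Swaps.

(** Without edges there are no versals, whence 0 < m. On one vertex, [singletons] and [cosingletons]
    have a single edge, for which both subsets are vacuously versals, whence n <> 1. *)
Theorem mainTheorem1 (V : finType) (E : {set {set V}}) (n m : nat)
    (hn : #|V| = n) (hm : #|E| = m) (hE : antichain E) :
  (0 < m -> ~ exceptional E -> n + 1 <= #|versals E|) /\
  (n <> 1 -> exceptional E -> #|versals E| = n).
Proof.
rewrite -hn -hm; split=> [m0 nex|/eqP n1].
  by rewrite addn1 card_versals_ge // -card_gt0.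
case=> [->|->|/versals_C4 [-> ->] //].
  by rewrite versals_singletons // card_cosingletons.
by rewrite versals_cosingletons // card_singletons.
Qed.
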